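(* Let $b\ge 2$ be an integer and let $\Gamma=K_b\square K_b$. Then $\Gamma$ is vertex-transitive, edge-transitive, and strongly regular with parameters $(b^2,2b-2,b-2,2)$. Furthermore, $\Gamma$ is a $b$-partite graph with parts of cardinality $b$. In fact, $K_b$ is a normal quotient of $\Gamma$ relative to a vertex-transitive subgroup of $\mathrm{Aut}(\Gamma)$, and $\Gamma$ is a $2$-multicover of this quotient; that is, there exist a vertex-transitive subgroup $G\le\mathrm{Aut}(\Gamma)$ and a normal subgroup $1\neq N\triangleleft G$, intransitive on $V(\Gamma)$, such that $\Gamma_N\cong K_b$ and $\Gamma$ is a $2$-multicover of $\Gamma_N$.
   Context: $K_b\square K_b$ is the graph whose vertices are the pairs $(i,j)$ with $i,j\in\mathbb{Z}_b$, where $(i,j)$ and $(i',j')$ are adjacent if and only if $i=i'$ or $j=j'$ but not both. A strongly regular graph with parameters $(n,k,\lambda,\mu)$ is a (finite, simple) regular graph with $n$ vertices and valency $k$, such that each pair of adjacent vertices lies in exactly $\lambda$ triangles and each pair of distinct non-adjacent vertices (if such exist) is joined by exactly $\mu$ paths of length 2. Quotient graph: if $G\le\mathrm{Aut}(\Gamma)$ is vertex-transitive and $1\neq N\triangleleft G$ is intransitive on $V(\Gamma)$, then $\Gamma_N$ is the graph whose vertices are the orbits of $N$ on $V(\Gamma)$, two distinct orbits $B,B'$ being adjacent if and only if some vertex of $B$ is adjacent in $\Gamma$ to some vertex of $B'$. $\Gamma$ is an $\ell$-multicover of $\Gamma_N$ if for each pair $\{B,B'\}$ of adjacent $N$-orbits,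 each vertex in $B$ is adjacent to exactly $\ell$ vertices in $B'$ (with $\ell$ independent of the choice of $\{B,B'\}$). *)

(* Defs.v *)
From mathcomp Require Import all_boot all_fingroup zmodp.

Set Implicit Arguments.
Unset Strict Implicit.
Unset Printing Implicit Defensive.

Record sgraph := SGraph {
  vertex :> finType;
  adj : rel vertex;
  adj_sym : symmetric adj;
  adj_irrefl : irreflexive adj
}.

Definition graph_iso (G H : sgraph) : Prop :=
  exists2 f : G -> H, bijective f & forall x y, adj (f x) (f y) = adj x y.

Section Graph.

Variable G : sgraph.

Definition edges : {set {set G}} :=
  [set [set p.1; p.2] | p : G * G & adj p.1 p.2].

Definition independent (A : {set G}) : Prop :=
  forall x y, x \in A -> y \in A -> ~~ adj x y.

Definition valency (x : G) : nat := #|[set y | adj x y]|.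

Definition triangles : {set {set G}} :=
  [set t : {set G} | (#|t| == 3) &&
     [forall x in t, forall y in t, (x != y) ==> adj x y]].

(* A path of length 2 starting at x is given by the pair of its other two
   vertices, in order. *)
Definition paths2 (x y : G) : {set 2.-tuple G} :=
  [set p : 2.-tuple G | [&& path (@adj G) x p, uniq (x :: p) & last x p == y]].

Definition strongly_regular (n k lambda mu : nat) : Prop :=
  [/\ #|G| = n,
      forall x : G, valency x = k,
      forall x y : G, adj x y ->
        #|[set t in triangles | (x \in t) && (y \in t)]| = lambda
    & forall x y : G, x != y -> ~~ adj x y -> #|paths2 x y| = mu].

Definition multipartite (m s : nat) : Prop :=
  exists P : {set {set G}},
    [/\ partition P [set: G], #|P| = m
      & forall B, B \in P -> #|B| = s /\ independent B].

Definition graph_aut : {set {perm G}} :=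
  [set s : {perm G} | [forall x, forall y, adj (s x) (s y) == adj x y]].

Lemma graph_aut_group_set : group_set graph_aut.
Proof.
apply/group_setP; split=> [|s t].
  by rewrite inE; apply/forallP=> x; apply/forallP=> y; rewrite !perm1.
rewrite !inE => /forallP aut_s /forallP aut_t.
apply/forallP=> x; apply/forallP=> y; rewrite !permM.
by rewrite (eqP (forallP (aut_t _) _)) (eqP (forallP (aut_s _) _)).
Qed.

Canonical graph_aut_group := Group graph_aut_group_set.

Definition vtransitive_group (H : {group {perm G}}) : bool :=
  [transitive H, on [set: G] | 'P].

Definition vertex_transitive : bool := vtransitive_group graph_aut_group.

Definition edge_transitive : bool := [transitive graph_aut, on edges | 'P^*].

Section Quotient.

Variable N : {group {perm G}}.

Definition orbits : {set {set G}} := [set orbit 'P N x | x : G].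

Definition quot_vertex : finType := {B : {set G} | B \in orbits}.

Definition quot_adj : rel quot_vertex := fun B B' =>
  (B != B') && [exists x in val B, exists y in val B', adj x y].

Lemma quot_adj_sym : symmetric quot_adj.
Proof.
move=> B B'; rewrite /quot_adj eq_sym; congr (_ && _).
apply/exists_inP/exists_inP => -[x Bx /exists_inP[y By xy]];
  by exists y => //; apply/exists_inP; exists x; rewrite // adj_sym.
Qed.

Lemma quot_adj_irrefl : irreflexive quot_adj.
Proof. by move=> B; rewrite /quot_adj eqxx. Qed.

Definition quotient_graph : sgraph := SGraph quot_adj_sym quot_adj_irrefl.

Definition multicover (l : nat) : Prop :=
  forall B B' : quotient_graph, adj B B' ->
    forall x, x \in val B -> #|[set y in val B' | adj x y]| = l.

End Quotient.

End Graph.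

(* For b <= 1 the type 'Z_b still has two elements, so the graphs below are
   the intended ones only for 1 < b. *)
Definition complete_adj b : rel 'Z_b := fun i j => i != j.

Lemma complete_adj_sym b : symmetric (@complete_adj b).
Proof. by move=> i j; rewrite /complete_adj eq_sym. Qed.

Lemma complete_adj_irrefl b : irreflexive (@complete_adj b).
Proof. by move=> i; rewrite /complete_adj eqxx. Qed.

Definition complete_graph b : sgraph :=
  SGraph (@complete_adj_sym b) (@complete_adj_irrefl b).

Definition rook_adj b : rel ('Z_b * 'Z_b) := fun u v =>
  (u.1 == v.1) (+) (u.2 == v.2).

Lemma rook_adj_sym b : symmetric (@rook_adj b).
Proof. by move=> u v; rewrite /rook_adj eq_sym [u.2 == _]eq_sym. Qed.

Lemma rook_adj_irrefl b : irreflexive (@rook_adj b).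
Proof. by move=> u; rewrite /rook_adj !eqxx. Qed.

Definition rook_graph b : sgraph :=
  SGraph (@rook_adj_sym b) (@rook_adj_irrefl b).

(* Main.v *)
Require Import Defs.
From mathcomp Require Import all_boot all_fingroup ssralg finalg zmodp.

Set Implicit Arguments.
Unset Strict Implicit.
Unset Printing Implicit Defensive.

Import GRing.Theory.

(** The graph is the rook graph of the [b] by [b] board over [Z_b]: two squares
are adjacent when they share exactly one coordinate.

Its automorphisms include all pairs of permutations of the two coordinates,
and the swap of the coordinates. As the symmetric group is 2-transitive, the
pairs of permutations carry the arc from (0,0) to (0,1) to every arc whose
ends share their first coordinate; the swap reaches the remaining arcs, hence
the graph is edge-transitive ([rook_edge_transitive]). The translations alone
are already vertex-transitive.

Both constants of strong regularity are numbers of common neighbours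
([card_triangles_common], [card_paths2_common]). Two squares on a line have as
common neighbours the other [b - 2] squares of that line; two squares (i,j)
and (k,l) on no common line have the two other corners (i,l) and (k,j) of
their rectangle.

For the quotient, take for [G] the group of all translations of [Z_b * Z_b]
and for [N] the translations by diagonal vectors (c,c); [N] is normal because
[G] is abelian. The direction of [N] is what matters: translations along a
single coordinate would have cliques as orbits and give a 1-multicover. The
orbits of [N] are the [b] diagonals [j - i = d] ([orbit_diag_translations]).
Two different squares of a diagonal differ in both coordinates, so diagonals
are independent sets of size [b]. A square off a given diagonal sees exactly
two squares of it, one along each of its two lines, and these are different
([rook_multicover]); in particular all diagonals are pairwise adjacent and
the quotient is [K_b] ([quotient_complete]). *)

(** * Common neighbours and arcs in a graph *)

Section Graphs.

Variable G : sgraph.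

Definition common_nbrs (x y : G) : {set G} := [set z | adj x z && adj z y].

Lemma adj_neq (x y : G) : adj x y -> x != y.
Proof. by apply: contraTneq => ->; rewrite adj_irrefl. Qed.

(** The triangles on the edge [{x, y}] correspond to their third vertex [z], by
[z |-> {x, y, z}]. *)
Lemma card_triangles_common (x y : G) : adj x y ->
  #|[set t in triangles G | (x \in t) && (y \in t)]| = #|common_nbrs x y|.
Proof.
move=> xy; have nxy := adj_neq xy.
have third z : z \in common_nbrs x y -> (x != z) && (y != z).
  by rewrite inE => /andP[/adj_neq-> /adj_neq]; rewrite eq_sym.
rewrite -(card_in_imset (f := fun z => x |: [set y; z])); last first.
  move=> z w /third/andP[xz yz] _ /setP/(_ z).
  by rewrite !inE eqxx !orbT ![z == _]eq_sym (negPf xz) (negPf yz) => /esym/eqP.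
apply: eq_card => t; rewrite !inE -andbA; apply/idP/imsetP => [|[z cz ->]].
  case/and4P=> /eqP t3 /forall_inP clq tx ty.
  (* The third vertex is what is left of the triangle without [x] and [y]. *)
  have /eqP/cards1P[z tz]: #|t :\ x :\ y| = 1.
    have /eqP := cardsD1 x t; rewrite t3 tx eqSS.
    by rewrite (cardsD1 y (t :\ x)) !inE [y == x]eq_sym nxy ty /= eqSS => /eqP <-.
  have : z \in t :\ x :\ y by rewrite tz set11.
  rewrite !inE => /and3P[zy zx zt].
  exists z; last by rewrite -tz (@setD1K _ y) ?setD1K // !inE ty andbT eq_sym.
  have adjt u v : u \in t -> v \in t -> u != v -> adj u v.
    by move=> tu tv; apply/implyP; move/forall_inP: (clq u tu); apply.
  by rewrite inE !adjt // eq_sym.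
have /andP[xz yz] := third z cz; move: cz; rewrite inE => /andP[axz azy].
rewrite !inE !eqxx !orbT !andbT cardsU1 cards2 !inE negb_or nxy xz yz /=.
apply/forall_inP=> u; rewrite !inE => /or3P[]/eqP->; apply/forall_inP=> v;
  rewrite !inE => /or3P[]/eqP->; rewrite ?eqxx ?xy ?axz ?azy ?implybT //;
  by rewrite adj_sym ?xy ?axz ?azy implybT.
Qed.

(** A path of length 2 from [x] to [y] is determined by its middle vertex. *)
Lemma card_paths2_common (x y : G) : x != y ->
  #|paths2 x y| = #|common_nbrs x y|.
Proof.
move=> nxy; rewrite -(card_imset (f := fun z => [tuple z; y])); last first.
  by move=> z w [].
apply: eq_card => p; rewrite inE; apply/idP/imsetP => [|[z cz ->]].
  case: (tupleP p) => z q; case: (tupleP q) => w r; rewrite (tuple0 r) /=.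
  rewrite andbT => /and3P[/andP[xz zw] _ /eqP def_w].
  exists z; first by rewrite inE xz -def_w.
  by apply: val_inj; rewrite /= def_w.
move: cz; rewrite inE => /andP[xz zy] /=.
by rewrite xz zy !inE negb_or nxy (adj_neq xz) (adj_neq zy) eqxx.
Qed.

(** An edge is the unordered pair of the ends of an arc, so reaching every arc
from one base arc is enough. *)
Lemma edge_transitive_arc (x0 y0 : G) : adj x0 y0 ->
    (forall x y, adj x y ->
       exists2 s : {perm G}, s \in graph_aut G & s x0 = x /\ s y0 = y) ->
  edge_transitive G.
Proof.
move=> xy0 arc; apply/imsetP; exists [set x0; y0].
  by apply/imsetP; exists (x0, y0); rewrite ?inE.
apply/setP=> e; apply/imsetP/orbitP => [[[x y]]|[s aut_s <-]].
  rewrite inE /= => xy ->; have [s aut_s [sx sy]] := arc x y xy.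
  by exists s; rewrite //= /setact imsetU1 imset_set1 /= /aperm sx sy.
exists (s x0, s y0); rewrite ?inE; last by rewrite /= /setact imsetU1 imset_set1.
by move: aut_s; rewrite !inE => /forallP/(_ x0)/forallP/(_ y0)/eqP->.
Qed.

End Graphs.

(** The symmetric group is 2-transitive: first send [x] to [x'], then move the
image of [y], which differs from [x'], to [y'] while fixing [x']. *)
Lemma perm_two_points (T : finType) (x y x' y' : T) : x != y -> x' != y' ->
  exists s : {perm T}, s x = x' /\ s y = y'.
Proof.
move=> nxy nxy'; exists (tperm x x' * tperm (tperm x x' y) y')%g.
rewrite !permM tpermL; split; last by rewrite tpermL.
rewrite tpermD 1?eq_sym // -[X in X == _](tpermL x x').
by rewrite (inj_eq perm_inj).
Qed.

(** * Automorphisms and edge-transitivity of the rook graph *)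

Section Rook.

Variable b : nat.
Hypothesis b_gt1 : 1 < b.

Local Notation V := ('Z_b * 'Z_b)%type.
Local Notation rook := (rook_graph b).

Lemma card_Zb : #|'Z_b| = b.
Proof. by rewrite card_ord Zp_cast. Qed.

Lemma prod_perm_inj (s t : {perm 'Z_b}) :
  injective ((fun u => (s u.1, t u.2)) : V -> V).
Proof. by move=> [u1 u2] [v1 v2] [/perm_inj-> /perm_inj->]. Qed.

Definition prod_perm s t : {perm rook} := perm (@prod_perm_inj s t).

Lemma prod_permE s t (u : rook) : prod_perm s t u = (s u.1, t u.2).
Proof. exact: permE. Qed.

Lemma prod_perm_aut s t : prod_perm s t \in graph_aut rook.
Proof.
rewrite inE; apply/forallP=> u; apply/forallP=> v.
by rewrite !prod_permE /= /rook_adj /= !(inj_eq perm_inj).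
Qed.

Lemma swap_inj : injective ((fun u => (u.2, u.1)) : V -> V).
Proof. by move=> [u1 u2] [v1 v2] [-> ->]. Qed.

Definition swap_perm : {perm rook} := perm swap_inj.

Lemma swap_perm_aut : swap_perm \in graph_aut rook.
Proof.
rewrite inE; apply/forallP=> u; apply/forallP=> v.
by rewrite !permE /= /rook_adj /= addbC.
Qed.

Lemma rook_edge_transitive : edge_transitive rook.
Proof.
pose x0 : rook := (0, 0)%R; pose y0 : rook := (0, 1)%R.
have row (u v : rook) : u.1 = v.1 -> u.2 != v.2 ->
    exists2 s : {perm rook}, s \in graph_aut rook & s x0 = u /\ s y0 = v.
  case: u v => [u1 u2] [_ v2] /= <- nuv.
  have n01 : 0%R != 1%R :> 'Z_b by rewrite eq_sym oner_neq0.
  have [t [t0 t1]] := perm_two_points n01 nuv.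
  exists (prod_perm (tperm (0%R : 'Z_b) u1) t); first exact: prod_perm_aut.
  by rewrite !prod_permE /= tpermL t0 t1.
apply: (@edge_transitive_arc rook x0 y0) => [//|u v].
rewrite /= /rook_adj; case: eqP => [uv1 | /eqP nuv1].
  by rewrite addTb => nuv2; apply: row.
rewrite addFb => /eqP uv2.
(* The swap turns this arc into one whose ends share their first coordinate. *)
have [s aut_s [su sv]] := row (u.2, u.1) (v.2, v.1) uv2 nuv1.
exists (s * swap_perm)%g; first exact: groupM aut_s swap_perm_aut.
by rewrite !permM su sv !permE /= -!surjective_pairing.
Qed.

(** * Strong regularity *)

Lemma rook_valency (u : rook) : valency u = 2 * b - 2.
Proof.
pose rowu := setX [set u.1] [set~ u.2]; pose colu := setX [set~ u.1] [set u.2].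
have disj : [disjoint rowu & colu].
  rewrite disjoint_subset; apply/subsetP=> -[v1 v2].
  by rewrite !inE => /andP[-> _].
rewrite /valency; have -> : [set v | adj u v] = rowu :|: colu.
  apply/setP=> -[v1 v2]; rewrite !inE /= /rook_adj /= [v1 == _]eq_sym.
  by rewrite [v2 == _]eq_sym; do 2!case: eqP.
rewrite cardsU (disjoint_setI0 disj) cards0 subn0 !cardsX !cards1 !cardsC1.
by rewrite card_Zb mul1n muln1 addnn -subn1 -mul2n mulnBr.
Qed.

(** A common neighbour of two vertices of a line stays on that line: off it, it
would have to share with each of them the coordinate in which they differ. *)
Lemma rook_lambda (u v : rook) : adj u v -> #|common_nbrs u v| = b - 2.
Proof.
have off2 (i j : 'Z_b) : i != j -> #|~: [set i; j]| = b - 2.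
  by move=> nij; rewrite cardsCs setCK card_Zb cards2 nij.
case: u v => [u1 u2] [v1 v2]; rewrite /= /rook_adj /=.
case: eqP => [<- | /eqP nuv1].
  rewrite addTb => nuv2.
  rewrite -(off2 _ _ nuv2) -[RHS]mul1n -(cards1 u1) -cardsX.
  apply: eq_card => -[w1 w2]; rewrite !inE /= /rook_adj /= eq_sym.
  rewrite [w2 == u2]eq_sym; case: (eqVneq w1 u1) => [_|nw] /=.
    by rewrite negb_or.
  by case: eqP => //= <-; rewrite (negPf nuv2).
rewrite addFb => /eqP <-.
rewrite -(off2 _ _ nuv1) -[RHS]muln1 -(cards1 u2) -cardsX.
apply: eq_card => -[w1 w2]; rewrite !inE /= /rook_adj /= [u2 == _]eq_sym.
rewrite [w1 == u1]eq_sym; case: (eqVneq w2 u2) => [_|nw] /=.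
  by rewrite !addbT negb_or andbT.
by rewrite !addbF andbF; case: eqP => //= <-; rewrite (negPf nuv1).
Qed.

(** The common neighbours are the two other corners of the rectangle spanned by
[u] and [v]. *)
Lemma rook_mu (u v : rook) : u != v -> ~~ adj u v -> #|common_nbrs u v| = 2.
Proof.
case: u v => [u1 u2] [v1 v2]; rewrite xpair_eqE /= /rook_adj /= => nuv nadj.
have [nuv1 nuv2] : u1 != v1 /\ u2 != v2 by move: nuv nadj; do 2!case: eqP.
transitivity #|[set (u1, v2); (v1, u2)]|; last first.
  by rewrite cards2 xpair_eqE (negPf nuv1).
apply: eq_card => -[w1 w2]; rewrite !inE !xpair_eqE /= /rook_adj /=.
rewrite [u1 == _]eq_sym [u2 == _]eq_sym.
case: (eqVneq w1 u1) => [->|_]; case: (eqVneq w2 u2) => [->|_] /=;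
  by rewrite ?(negPf nuv1) ?(negPf nuv2) ?addbF ?orbF ?andbF ?andbT.
Qed.

Lemma rook_strongly_regular :
  strongly_regular rook (b ^ 2) (2 * b - 2) (b - 2) 2.
Proof.
split=> [|u|u v uv|u v nuv nadj].
- by rewrite card_prod card_Zb.
- exact: rook_valency.
- by rewrite card_triangles_common // rook_lambda.
- by rewrite card_paths2_common // rook_mu.
Qed.

(** * Translations and the quotient by the diagonal translations *)

(** Right multiplication in the direct product of two copies of the additive
group of [Z_b] is addition of a vector, so the right regular action yields
the translations. *)
Definition translations : {group {perm rook}} := (actperm 'R @* [set: V])%G.

Definition diag_sub : {set V} := [set c | c.1 == c.2].

Lemma diag_sub_group_set : group_set diag_sub.
Proof.
apply/group_setP; split=> [|c d]; rewrite !inE //.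
by move=> /eqP c12 /eqP d12; rewrite /= c12 d12.
Qed.

Canonical diag_sub_group := Group diag_sub_group_set.

Definition diag_translations : {group {perm rook}} :=
  (actperm 'R @* diag_sub)%G.

Definition diagonal (d : 'Z_b) : {set rook} := [set u : V | (u.2 - u.1 == d)%R].

(** The orbits are the cosets of the diagonal subgroup, which is the kernel of
the difference of the two coordinates. *)
Lemma orbit_diag_translations (u : rook) :
  orbit 'P diag_translations u = diagonal (u.2 - u.1)%R.
Proof.
rewrite /= orbit_morphim_actperm ?subsetT // orbitR.
apply/setP=> v; rewrite mem_lcoset !inE /= !FinRing.zmodMgE !FinRing.zmodVgE.
rewrite !subr_eq eq_sym ![(- _ + _)%R]addrC subr_eq.
by rewrite [(u.2 - _ + _)%R]addrC addrA addrAC.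
Qed.

Lemma translations_aut : translations \subset graph_aut rook.
Proof.
apply/subsetP=> _ /morphimP[c _ _ ->]; rewrite inE; apply/forallP=> u.
apply/forallP=> v; rewrite !actpermE /= /rook_adj /=.
by rewrite !(inj_eq (mulIg _)).
Qed.

Lemma translations_transitive : vtransitive_group translations.
Proof.
apply/imsetP; exists (0, 0)%R => //; apply/esym/setP=> u.
by rewrite orbit_morphim_actperm // orbitR mem_lcoset !inE.
Qed.

Lemma rook_vertex_transitive : vertex_transitive rook.
Proof.
apply/imsetP; exists (0, 0)%R => //; apply/esym/eqP.
rewrite eqEsubset subsetT -(atransP translations_transitive (0, 0)%R (in_setT _)).
exact: imsetS translations_aut.
Qed.

Lemma diag_translations_normal : (diag_translations <| translations)%g.
Proof.
apply: morphim_normal; rewrite -sub_abelian_normal ?subsetT //.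
by apply/centsP=> -[x1 x2] _ [y1 y2] _; congr pair; apply: addrC.
Qed.

Lemma diag_translations_neq1 : diag_translations :!=: 1%g.
Proof.
apply/eqP=> N1.
have : (1, 1)%R \in orbit 'P diag_translations (0, 0)%R.
  by rewrite orbit_diag_translations inE /= !subrr.
rewrite N1 => /orbitP[_ /set1P->]; rewrite /= /aperm perm1 => -[/eqP].
by rewrite eq_sym oner_eq0.
Qed.

Lemma diag_translations_intransitive : ~~ vtransitive_group diag_translations.
Proof.
apply/negP=> /atransP/(_ (0, 0)%R (in_setT _)).
rewrite orbit_diag_translations => /setP/(_ (0, 1)%R).
by rewrite !inE /= !subr0 oner_eq0.
Qed.

Lemma diagonalE d : diagonal d = [set (i, i + d)%R | i : 'Z_b].
Proof.
apply/setP=> u; rewrite inE; apply/eqP/imsetP=> [<-|[i _ ->]].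
  by exists u.1; rewrite // addrC subrK -surjective_pairing.
by rewrite /= addrC addKr.
Qed.

Lemma card_diagonal d : #|diagonal d| = b.
Proof. by rewrite diagonalE card_imset ?card_Zb // => i j []. Qed.

Lemma diagonal_inj : injective diagonal.
Proof.
by move=> d e /setP/(_ (0, d)%R); rewrite !inE /= subr0 eqxx => /esym/eqP.
Qed.

(** On a diagonal either coordinate determines the other, so two of its vertices
agree in both coordinates or in none. *)
Lemma diagonal_independent d : independent (diagonal d).
Proof.
move=> [u1 u2] [v1 v2]; rewrite !inE /= /rook_adj /= !subr_eq => /eqP-> /eqP->.
by rewrite (inj_eq (addrI d)) addbb.
Qed.

Lemma orbits_diag_translations :
  orbits diag_translations = [set diagonal d | d : 'Z_b].
Proof.
apply/setP=> B; apply/imsetP/imsetP=> [[u _ ->]|[d _ ->]].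
  by exists (u.2 - u.1)%R; rewrite // orbit_diag_translations.
by exists (0, d)%R; rewrite // orbit_diag_translations subr0.
Qed.

Lemma rook_multipartite : multipartite rook b b.
Proof.
exists (orbits diag_translations); split.
- have -> : orbits diag_translations
          = [set orbit 'P diag_translations x | x in [set: rook]].
    by apply/setP=> B; apply/imsetP/imsetP=> -[u _ ->]; exists u.
  by apply: orbit_partition; apply/actsP=> s _ u; rewrite !inE.
- rewrite orbits_diag_translations card_imset ?card_Zb //.
  exact: diagonal_inj.
- move=> B; rewrite orbits_diag_translations => /imsetP[d _ ->].
  by split; [apply: card_diagonal | apply: diagonal_independent].
Qed.

Local Notation quotient := (quotient_graph diag_translations).

Lemma diagonal_orbit d : diagonal d \in orbits diag_translations.
Proof. by rewrite orbits_diag_translations imset_f. Qed.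

(** The inverse of the isomorphism from the quotient onto [K_b]. *)
Definition diag_class (d : 'Z_b) : quotient :=
  exist (fun B : {set rook} => B \in orbits diag_translations) _
    (diagonal_orbit d).

Lemma diag_class_bij : bijective diag_class.
Proof.
apply: inj_card_bij => [d e [] /diagonal_inj //|].
rewrite card_sig orbits_diag_translations.
by rewrite (card_imset _ diagonal_inj) card_Zb.
Qed.

Lemma adj_diag_class d e : adj (diag_class d) (diag_class e) = (d != e).
Proof.
rewrite /= /quot_adj /= (inj_eq (bij_inj diag_class_bij)).
case: eqVneq => //= nde; apply/exists_inP; exists (0, d)%R.
  by rewrite inE /= subr0.
apply/exists_inP; exists (0, e)%R; first by rewrite inE /= subr0.
by rewrite /= /rook_adj /= nde.
Qed.

Lemma quotient_complete : graph_iso quotient (complete_graph b).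
Proof.
have [f classK fK] := diag_class_bij; exists f; first by exists diag_class.
by move=> B B'; rewrite -{2}[B]fK -{2}[B']fK adj_diag_class.
Qed.

(** A vertex (i, d + i) outside the diagonal of index [e] sees in it the vertex
with first coordinate [i] and the one with second coordinate [d + i], whose
first coordinate is [i + d - e]; these are distinct because [d != e]. *)
Lemma rook_multicover : multicover diag_translations 2.
Proof.
have [f _ fK] := diag_class_bij.
move=> B B'; rewrite -[B]fK -[B']fK adj_diag_class.
move: (f B) (f B') => d e nde [i j] /=; rewrite inE subr_eq /= => /eqP->.
pose h k : rook := (k, k + e)%R.
have adj_h k : rook_adj (i, d + i)%R (h k) = (k \in [set i; (i + d - e)%R]).
  rewrite !inE /rook_adj /= [i == k]eq_sym [k == (_ - _)%R]eq_sym subr_eq.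
  rewrite [(d + i)%R]addrC; case: (eqVneq k i) => //= ->.
  by rewrite (inj_eq (addrI i)) nde.
transitivity #|[set h k | k in [set i; (i + d - e)%R]]|; last first.
  rewrite card_imset => [|k l [] //].
  by rewrite cards2 eq_sym subr_eq (inj_eq (addrI i)) nde.
apply: eq_card => y; rewrite inE diagonalE.
apply/andP/imsetP=> [[/imsetP[k _ ->] hk]|[k hk ->]]; last first.
  by split; [apply: imset_f | rewrite adj_h].
by exists k; rewrite // -adj_h.
Qed.

End Rook.

Theorem proposition4p1 (b : nat) (hb : 2 <= b) :
  [/\ vertex_transitive (rook_graph b),
      edge_transitive (rook_graph b)
    & strongly_regular (rook_graph b) (b ^ 2) (2 * b - 2) (b - 2) 2]
  /\ multipartite (rook_graph b) b b
  /\ exists G N : {group {perm rook_graph b}},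
       [/\ G \subset graph_aut (rook_graph b) /\ vtransitive_group G,
           [/\ (N <| G)%g, N :!=: 1%g & ~~ vtransitive_group N],
           graph_iso (quotient_graph N) (complete_graph b)
         & multicover N 2].
Proof.
split.
  split; [exact: rook_vertex_transitive | exact: rook_edge_transitive |].
  exact: rook_strongly_regular.
split; first exact: rook_multipartite.
exists (translations b), (diag_translations b); split.
- by split; [apply: translations_aut | apply: translations_transitive].
- split; [exact: diag_translations_normal | exact: diag_translations_neq1 |].
  exact: diag_translations_intransitive.
- exact: quotient_complete.
- exact: rook_multicover.
Qed.
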